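(* The strata of the cactus rank stratification of the projective space $\mathbb{P}(\mathbb{C}[X_0,X_1]_4)$ of binary quartic forms are given by $$\mathrm{crank}^{-1}(1)=\mathrm{im}(v_4),\qquad \mathrm{crank}^{-1}(2)=Z(g_3)\setminus\mathrm{im}(v_4),\qquad \mathrm{crank}^{-1}(3)=\mathbb{P}(\mathbb{C}[X_0,X_1]_4)\setminus Z(g_3).$$
   Context: $\mathbb{C}[X_0,X_1]_k$ is the space of homogeneous polynomials of degree $k$. For $P\in\mathbb{C}[X_0,X_1]$ let $\mathrm{Ann}(P)=\{Q\in\mathbb{C}[\xi_0,\xi_1]\mid Q(\frac{\partial}{\partial X_0},\frac{\partial}{\partial X_1})(P)=0\}$. The cactus rank $\mathrm{crank}(P)$ of a non-trivial binary form $P$ is the minimal length of a $0$-dimensional subscheme $Z\subset\mathbb{P}^1_{\mathbb{C}}$ defined by a homogeneous saturated ideal $I_Z$ contained in $\mathrm{Ann}(P)$; it depends only on $[P]$. The strata are the level sets $\mathrm{crank}^{-1}(r)=\{[P]\in\mathbb{P}(\mathbb{C}[X_0,X_1]_4)\mid\mathrm{crank}(P)=r\}$. $v_4:\mathbb{P}(\mathbb{C}[X_0,X_1]_1)\to\mathbb{P}(\mathbb{C}[X_0,X_1]_4)$, $[\lambda]\mapsto[\lambda^4]$, is the Veronese map. For $Q=a_0X_0^4+4a_1X_0^3X_1+6a_2X_0^2X_1^2+4a_3X_0X_1^3+a_4X_1^4$ put $$g_3(Q)=a_0a_2a_4+2a_1a_2a_3-a_2^3-a_0a_3^2-a_1^2a_4,$$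 and $Z(g_3)\subset\mathbb{P}(\mathbb{C}[X_0,X_1]_4)$ is its zero locus. *)

(* Defs.v *)
From HB Require Import structures.
From mathcomp Require Import all_boot all_order all_algebra.
From mathcomp Require Import ring_quotient.
From mathcomp Require Import boolp classical_sets reals.
From mathcomp Require Import complex.
From mathcomp Require Import mpoly.
From mathcomp Require Import ring.

Set Implicit Arguments.
Unset Strict Implicit.
Unset Printing Implicit Defensive.

Import GRing.Theory.

Local Open Scope ring_scope.
Local Open Scope classical_set_scope.

(* P(V): the points are the lines of V, i.e. its 1-dimensional subspaces. *)
Definition projSpace (F : fieldType) (V : vectType F) :=
  {L : {vspace V} | \dim L == 1%N}.

Lemma dim_line_eq1 (F : fieldType) (V : vectType F) (v : V) :
  v != 0 -> \dim <[v]>%VS == 1%N.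
Proof. by rewrite dim_vline => ->. Qed.

(* [v], for v != 0 *)
Definition projPt (F : fieldType) (V : vectType F) (v : V) (v0 : v != 0) :
  projSpace V := exist _ <[v]>%VS (dim_line_eq1 v0).

Lemma projPtP (F : fieldType) (V : vectType F) (v w : V)
    (v0 : v != 0) (w0 : w != 0) :
  projPt v0 = projPt w0 <-> exists2 c : F, c != 0 & v = c *: w.
Proof.
split=> [/(congr1 val)/= e|[c c0 e]]; last first.
  apply/val_inj => /=; apply/eqP; rewrite e.
  have cw0 : c *: w != 0 by rewrite scaler_eq0 negb_or c0.
  by rewrite eqEdim !dim_vline w0 cw0 andbT -memvE memvZ // memv_line.
have : v \in <[w]>%VS by rewrite -e memv_line.
case/vlineP => c ec; exists c => //.
by apply: contraNneq v0 => c0; rewrite ec c0 scale0r.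
Qed.

Lemma vpick_projSpace_neq0 (F : fieldType) (V : vectType F) (x : projSpace V) :
  vpick (val x) != 0.
Proof.
by rewrite vpick0; apply/negP => /eqP e; have := svalP x; rewrite e dimv0.
Qed.

Section BinaryForms.
Variable C : fieldType.

(* C[X_0, X_1]; also used for the ring C[xi_0, xi_1] of the dual variables. *)
Notation S := {mpoly C[2]}.
Notation form k := (dhomog 2 C k).

(* Q(d/dX_0, d/dX_1)(P) *)
Definition diffop (Q P : S) : S := \sum_(m <- msupp Q) Q@_m *: P^`M[m].

Definition Ann (P : S) : {pred S} := [pred Q | diffop Q P == 0].

Definition homogeneous_ideal (I : {pred S}) : Prop :=
  forall f, f \in I -> forall d, pihomog mdeg d f \in I.

(* Saturation with respect to the irrelevant ideal m = (X_0, X_1): an f with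
   m^k f contained in I for some k is in I. *)
Definition saturated_ideal (I : {pred S}) : Prop :=
  forall f k, (forall m : 'X_{1..2}, mdeg m = k -> 'X_[m] * f \in I) -> f \in I.

(* dim (S/I)_d = r *)
Definition hilbert_value (I : {pred S}) (d r : nat) : Prop :=
  exists2 U : {vspace form d},
    (forall f : form d, (f \in U) = (val f \in I)) &
    (\dim U + r)%N = \dim {: form d}.

(* I is the homogeneous saturated ideal of a 0-dimensional subscheme of P^1 of
   length r: the Hilbert polynomial of S/I is the constant r.  The library's
   ideals are proper, so the subscheme is nonempty. *)
Definition zero_dim_subscheme (I : {pred S}) (r : nat) : Prop :=
  [/\ idealr_closed I, homogeneous_ideal I, saturated_ideal I &
      exists d0, forall d, (d0 <= d)%N -> hilbert_value I d r].

Definition apolar_length (P : S) (r : nat) : Prop :=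
  exists2 I : {pred S}, zero_dim_subscheme I r & {subset I <= Ann P}.

(* The default value 0 is taken only if no apolar subscheme exists; it cannot
   be confused with an actual length, since those are positive. *)
Definition crank (P : S) : nat :=
  if pselect (exists r, `[< apolar_length P r >]) is left h then ex_minn h
  else 0%N.

Lemma AnnZ (c : C) (P : S) : c != 0 -> Ann (c *: P) =i Ann P.
Proof.
move=> c0 Q; rewrite !inE.
suff -> : diffop Q (c *: P) = c *: diffop Q P by rewrite scaler_eq0 (negbTE c0).
rewrite /diffop scaler_sumr; apply: eq_bigr => m _.
by rewrite linearZ /= !scalerA mulrC.
Qed.

Lemma crankZ (c : C) (P : S) : c != 0 -> crank (c *: P) = crank P.
Proof.
move=> c0; rewrite /crank; suff -> : apolar_length (c *: P) = apolar_length P by [].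
apply/funext => r; apply/propext.
by split=> -[I zI sI]; exists I => // f /sI; rewrite AnnZ.
Qed.

Definition crank_stratum (k r : nat) : set (projSpace (form k)) :=
  [set x | exists (P : form k) (P0 : P != 0), x = projPt P0 /\ crank P = r].

Lemma crank_stratumP (k r : nat) (P : form k) (P0 : P != 0) :
  crank_stratum r (projPt P0) <-> crank P = r.
Proof.
split=> [[Q [Q0 [/projPtP[c c0 ->] <-]]]|rP]; last by exists P, P0.
by rewrite linearZ crankZ.
Qed.

Lemma form_pow_homog (d : nat) (l : form 1) : (val l) ^+ d \is d.-homog.
Proof. by have := dhomogMn d (valP l); rewrite mul1n. Qed.

Definition form_pow (d : nat) (l : form 1) : form d :=
  DHomog (form_pow_homog d l).

Lemma form_pow_neq0 (d : nat) (l : form 1) : l != 0 -> form_pow d l != 0.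
Proof. by move=> l0; rewrite -val_eqE /= expf_neq0. Qed.

(* [l] |-> [l ^ d], computed on a representative; see veroneseE. *)
Definition veronese (d : nat) (x : projSpace (form 1)) : projSpace (form d) :=
  projPt (form_pow_neq0 d (vpick_projSpace_neq0 x)).

Lemma veroneseE (d : nat) (l : form 1) (l0 : l != 0) :
  veronese d (projPt l0) = projPt (form_pow_neq0 d l0).
Proof.
apply/projPtP; set v := vpick _.
have /vlineP[c ec] : v \in <[l]>%VS by rewrite memv_pick.
exists (c ^+ d).
  apply: expf_neq0; apply/eqP => c0.
  by have := vpick_projSpace_neq0 (projPt l0); rewrite -/v ec c0 scale0r eqxx.
by apply/val_inj; rewrite /= ec exprZn.
Qed.

(* The a_i of Q = \sum_i 'C(4, i) a_i X_0 ^ (4 - i) X_1 ^ i. *)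
Definition qcoef (Q : S) (i : nat) : C :=
  Q@_(U_(0%R) *+ (4 - i) + U_(1%R) *+ i)%MM / 'C(4, i)%:R.

Definition g3 (Q : S) : C :=
  let a := qcoef Q in
  a 0%N * a 2%N * a 4%N + 2%:R * a 1%N * a 2%N * a 3%N - a 2%N ^+ 3
  - a 0%N * a 3%N ^+ 2 - a 1%N ^+ 2 * a 4%N.

Definition Zg3 : set (projSpace (form 4)) :=
  [set x | exists (Q : form 4) (Q0 : Q != 0), x = projPt Q0 /\ g3 Q = 0].

Lemma Zg3P (Q : form 4) (Q0 : Q != 0) : Zg3 (projPt Q0) <-> g3 Q = 0.
Proof.
split=> [[P [P0 [/projPtP[c c0 ->] gP]]]|gQ]; last by exists Q, Q0.
suff -> : g3 (val (c *: P)) = c ^+ 3 * g3 (val P) by rewrite gP mulr0.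
have E i : qcoef (val (c *: P)) i = c * qcoef (val P) i.
  by rewrite /qcoef mulrA -mcoeffZ.
rewrite /g3 /= !E; move: (qcoef _) => a.
ring.
Qed.

End BinaryForms.

Arguments crank_stratum {C} k r.
Arguments veronese {C} d x.
Arguments Zg3 {C}.

(* Main.v *)
Require Import Defs.
From HB Require Import structures.
From mathcomp Require Import all_boot all_order all_algebra.
From mathcomp Require Import ring_quotient.
From mathcomp Require Import boolp classical_sets reals complex mpoly.
From mathcomp Require Import ssrcomplements bigenough.
From mathcomp Require Import zify ring.

(** A subscheme of length [r] of P^1 has a nonzero equation of degree [r], and
    conversely every nonzero form of degree [r > 0] cuts out a subscheme of
    length [r].  Hence [crank P <= r] iff [Ann P] contains a nonzero form of
    degree [r], i.e. iff a catalecticant (Hankel) matrix of [P] has a nonzero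
    left kernel.  For quartics: [r = 3] gives a 4 x 2 matrix, which always has
    one; [r = 2] gives a 3 x 3 matrix with determinant [g3 P]; and [r = 1]
    forces the coefficients of [P] to be in geometric progression, i.e. [P] to
    be a multiple of a fourth power of a linear form.

    To find the form of degree [r] in the ideal [I] of a subscheme of length
    [r]: among the linear forms [X_0 - c X_1] for [r + 1] distinct values of
    [c], one is a nonzerodivisor modulo [I], for otherwise they would have
    [r + 1] linearly independent eigenvectors in [(S/I)_d], which has dimension
    [r] for large [d].  Multiplication by a high power of it embeds [(S/I)_r]
    into such an [(S/I)_d], so [(S/I)_r] has dimension at most [r < r + 1]. *)

Set Implicit Arguments.
Unset Strict Implicit.
Unset Printing Implicit Defensive.

Import GRing.Theory BigEnough.

Local Open Scope ring_scope.
Local Open Scope classical_set_scope.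

(** * Monomials and forms in two variables *)

Definition mnm2 (a b : nat) : 'X_{1..2} := (U_(0%R) *+ a + U_(1%R) *+ b)%MM.

Lemma mnm2_0 a b : mnm2 a b 0%R = a.
Proof. by rewrite mnmDE !mulmnE !mnm1E /= mul1n mul0n addn0. Qed.

Lemma mnm2_1 a b : mnm2 a b 1%R = b.
Proof. by rewrite mnmDE !mulmnE !mnm1E /= mul1n mul0n. Qed.

Lemma mnm2E (m : 'X_{1..2}) : m = mnm2 (m 0%R) (m 1%R).
Proof.
apply/mnmP => -[[|[|i]] hi] //.
  have -> : Ordinal hi = 0%R by apply/val_inj.
  by rewrite mnm2_0.
have -> : Ordinal hi = 1%R by apply/val_inj.
by rewrite mnm2_1.
Qed.

Lemma mdeg_mnm2 a b : mdeg (mnm2 a b) = (a + b)%N.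
Proof. by rewrite mdegD !mdegMn !mdeg1 !mul1n. Qed.

Lemma mnm2D a b c d : (mnm2 a b + mnm2 c d)%MM = mnm2 (a + c) (b + d).
Proof. by rewrite [LHS]mnm2E !(mnmDE _ (mnm2 a b)) !mnm2_0 !mnm2_1. Qed.

Lemma eq_mnm2 a b c d : (mnm2 a b == mnm2 c d) = (a == c) && (b == d).
Proof.
apply/eqP/andP => [e|[/eqP-> /eqP->]] //.
by rewrite -(mnm2_0 a b) -{2}(mnm2_1 a b) e mnm2_0 mnm2_1.
Qed.

Section Binary.
Variable C : fieldType.

Notation S := {mpoly C[2]}.
Notation form k := (dhomog 2 C k).

Lemma mpolyX_mnm2 a b : 'X_[mnm2 a b] = 'X_0 ^+ a * 'X_1 ^+ b :> S.
Proof. by rewrite mpolyXD !mpolyXn. Qed.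

Lemma dhomogXU (i : 'I_2) : ('X_i : S) \is 1.-homog.
Proof. by rewrite dhomogX /= mdeg1. Qed.

Lemma dhomog_exp1 (p : S) d : p \is 1.-homog -> p ^+ d \is d.-homog.
Proof. by move/dhomogMn => /(_ d); rewrite mul1n. Qed.

Lemma mpoly2P (p q : S) : (forall a b, p@_(mnm2 a b) = q@_(mnm2 a b)) -> p = q.
Proof. by move=> e; apply/mpolyP => m; rewrite (mnm2E m) e. Qed.

Lemma dhomog2P k (p q : S) : p \is k.-homog -> q \is k.-homog ->
  (forall i, (i <= k)%N -> p@_(mnm2 (k - i) i) = q@_(mnm2 (k - i) i)) -> p = q.
Proof.
move=> hp hq e; apply: mpoly2P => a b.
have [ek|ne] := eqVneq (a + b)%N k.
  by rewrite -[a](addnK b) ek e // -ek leq_addl.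
by rewrite (dhomog_nemf_coeff hp) ?(dhomog_nemf_coeff hq) //= mdeg_mnm2.
Qed.

Lemma val_formZ d (c : C) (f : form d) : val (c *: f) = c *: val f.
Proof. by []. Qed.

Lemma val_form_sum d (J : finType) (f : J -> form d) :
  val (\sum_j f j) = \sum_j val (f j).
Proof. exact: (raddf_sum (@mpoly_of_dhomog 2 C d)). Qed.

Lemma mcoeff_sum_mnm2 r (x : 'I_r.+1 -> C) (i : 'I_r.+1) :
  (\sum_(q < r.+1) x q *: 'X_[mnm2 (r - q) q])@_(mnm2 (r - i) i) = x i.
Proof.
rewrite raddf_sum (bigD1 i) //= mcoeffZ mcoeffX eqxx mulr1.
rewrite big1 ?addr0 // => j ji; rewrite mcoeffZ mcoeffX eq_mnm2 andbC.
by have /negbTE-> : (j != i :> nat) by []; rewrite mulr0.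
Qed.

Lemma dhomog_sum_mnm2 r (x : 'I_r.+1 -> C) :
  \sum_(q < r.+1) x q *: 'X_[mnm2 (r - q) q] \is [in C[2], r.-homog].
Proof.
apply: rpred_sum => q _; rewrite rpredZ //.
by rewrite dhomogX /= mdeg_mnm2 subnK // -ltnS.
Qed.

(** * Ideals of subschemes of P^1: a form of degree equal to the length *)

Section Ideal.
Variable I : {pred S}.
Hypothesis idI : idealr_closed I.

Lemma ideal_mul (a u : S) : u \in I -> a * u \in I.
Proof. by case: idI => I0 _ h uI; rewrite -[_ * _]addr0 h. Qed.

Lemma ideal_add (u v : S) : u \in I -> v \in I -> u + v \in I.
Proof. by case: idI => I0 _ h uI vI; rewrite -[u]mul1r h. Qed.

Lemma ideal_scale (c : C) (u : S) : u \in I -> c *: u \in I.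
Proof. by rewrite -mul_mpolyC; exact: ideal_mul. Qed.

Lemma ideal_scale_inv (c : C) (u : S) : c != 0 -> c *: u \in I -> u \in I.
Proof. by move=> c0 /(ideal_scale c^-1); rewrite scalerA mulVf ?scale1r. Qed.

Lemma ideal_sum (J : finType) (A : pred J) (F : J -> S) :
  (forall j, A j -> F j \in I) -> \sum_(j | A j) F j \in I.
Proof.
by case: idI => I0 _ _ h; apply: (big_ind (fun x => x \in I)) => //; exact: ideal_add.
Qed.

Lemma ideal_addr (u v : S) : u \in I -> u + v \in I -> v \in I.
Proof.
move=> uI uvI; have -> : v = (-1) * u + (u + v) by rewrite mulN1r addKr.
exact/ideal_add/uvI/ideal_mul.
Qed.

(** The degree-[d] part of the quotient by [I] has dimension [r], too small for [r + 1] independent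
    vectors: if the [f i] are free, their span meets [U] nontrivially by a dimension count. *)
Lemma hilbert_dependency d r (f : 'I_r.+1 -> form d) : hilbert_value I d r ->
  exists2 a : 'I_r.+1 -> C, (exists i, a i != 0) &
    \sum_i a i *: val (f i) \in I.
Proof.
move=> [U UE dU]; pose X := [tuple f i | i < r.+1].
suff [a ai aU] : exists2 a : 'I_r.+1 -> C, (exists i, a i != 0) &
    \sum_i a i *: X`_i \in U.
  exists a => //; move: aU; rewrite UE val_form_sum; congr (_ \in I).
  by apply: eq_bigr => i _; rewrite val_formZ -tnth_nth tnth_mktuple.
have [frX|] := boolP (free X); last first.
  move=> /freeP/existsNP[b /not_implyP[b0 /existsNP[j /eqP bi]]].
  by exists b; [exists j | rewrite b0 mem0v].
have := dimv_sum_cap <<X>>%VS U; have := dimvS (subvf (<<X>> + U)%VS).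
rewrite (eqP frX) size_tuple -dU => le1 e.
pose v := vpick (<<X>> :&: U)%VS.
have v0 : v != 0.
  rewrite vpick0 -dimv_eq0; apply: contraTneq le1 => c0.
  by move: e; rewrite c0 addn0 => ->; rewrite -ltnNge addnC ltn_add2r.
have /andP[vX vU] : (v \in <<X>>%VS) && (v \in U) by rewrite -memv_cap memv_pick.
exists (coord X ^~ v); last by rewrite -coord_span.
apply: contrapT => /forallNP h; move: v0; rewrite (coord_span vX) big1 ?eqxx// => i _.
by have /negP/negbNE/eqP -> := h i; rewrite scale0r.
Qed.

(** The linear form vanishing at the point [[c : 1]]. *)
Definition pencil (c : C) : S := 'X_0 - c *: 'X_1.

Lemma pencil_homog c : pencil c \is 1.-homog.
Proof. by rewrite rpredB ?rpredZ ?dhomogXU. Qed.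

(* Modulo [I], [X_0] acts on [f] as [c X_1], so only powers of [X_1] matter. *)
Lemma pencil_saturated (c : C) n f : saturated_ideal I ->
  pencil c * f \in I -> 'X_1 ^+ n * f \in I -> f \in I.
Proof.
move=> satI lf Xf; apply: (satI f n) => m.
rewrite (mnm2E m) mdeg_mnm2 mpolyX_mnm2; move: (m 0) (m 1) => a b en.
move: Xf; rewrite -{n}en; elim: a b => [|a IH] b Xf; first by rewrite expr0 mul1r.
have -> : 'X_0 ^+ a.+1 * 'X_1 ^+ b * f =
    ('X_0 ^+ a * 'X_1 ^+ b) * (pencil c * f) + c *: ('X_0 ^+ a * 'X_1 ^+ b.+1 * f).
  by rewrite /pencil -!mul_mpolyC !exprS; ring.
by apply/ideal_add/ideal_scale/IH; [exact: ideal_mul | rewrite addnS].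
Qed.

(** Since [pencil c] kills [f] modulo [I], each [pencil e] acts on [f] as [(c - e) X_1]; the nonzero
    scalars [c - e] are cancelled one by one. *)
Lemma pencil_prod (c : C) (s : seq C) f : c \notin s -> pencil c * f \in I ->
  \prod_(e <- s) pencil e * f \in I -> 'X_1 ^+ size s * f \in I.
Proof.
elim: s f => [|e s IH] f /=; first by rewrite big_nil.
rewrite inE negb_or => /andP[ce cs] lf; rewrite big_cons.
have -> : pencil e * \prod_(j <- s) pencil j * f =
   \prod_(j <- s) pencil j * (pencil c * f) +
   (c - e) *: (\prod_(j <- s) pencil j * ('X_1 * f)).
  by rewrite /pencil -!mul_mpolyC mpolyCB; ring.
move/(ideal_addr (ideal_mul _ lf))/ideal_scale_inv; rewrite subr_eq0 => /(_ ce).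
rewrite exprSr -mulrA; apply: IH => //.
by rewrite mulrCA ideal_mul.
Qed.

Lemma pencil_regular r (c : 'I_r.+1 -> C) d0 : injective c -> saturated_ideal I ->
  (forall d, (d0 <= d)%N -> hilbert_value I d r) ->
  exists i, forall d f, f \is d.-homog -> pencil (c i) * f \in I -> f \in I.
Proof.
move=> injc satI hI; apply: contrapT => /forallNP h.
have {h} /choice[df hdf] : forall i, exists df : nat * S,
    [/\ df.2 \is df.1.-homog, pencil (c i) * df.2 \in I & df.2 \notin I].
  move=> i; have /existsNP[d /existsNP[f /not_implyP[hf /not_implyP[lf /negP fI]]]] := h i.
  by exists (d, f).
(* Powers of [X_1] bring all the witnesses to one degree [N >= d0], where [r + 1] forms are
   dependent modulo [I]. *)
pose N := (d0 + \sum_i (df i).1)%N.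
have leN i : ((df i).1 <= N)%N by rewrite /N (bigD1 i) //=; lia.
pose g i := 'X_1 ^+ (N - (df i).1) * (df i).2.
have hg i : g i \is N.-homog.
  rewrite -[N](subnK (leN i)) dhomogM //; last by case: (hdf i).
  exact/dhomog_exp1/dhomogXU.
have [a [i ai]] := hilbert_dependency (fun i => DHomog (hg i)) (hI _ (leq_addr _ _)).
have lg j : pencil (c j) * g j \in I.
  by rewrite mulrCA ideal_mul //; case: (hdf j).
(* Modulo [I], the product of the pencils other than [pencil (c i)] kills every term of the
   dependency except the [i]-th. *)
pose s := [seq c j | j <- rem i (enum 'I_r.+1)].
have uE := enum_uniq 'I_r.+1.
move/(ideal_mul (\prod_(e <- s) pencil e)); rewrite (bigD1 i) //= mulrDr addrC.
move=> sI; have /ideal_addr/(_ sI) : \prod_(e <- s) pencil e *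
    (\sum_(j < r.+1 | j != i) a j *: g j) \in I.
  rewrite mulr_sumr; apply: ideal_sum => j ji.
  rewrite -scalerAr ideal_scale // (perm_big (c j :: rem (c j) s)) /=; last first.
    by rewrite perm_to_rem // map_f // mem_rem_uniq // inE ji mem_enum.
  by rewrite big_cons mulrAC mulrC ideal_mul.
rewrite -scalerAr => /(ideal_scale_inv ai)/pencil_prod gI.
have {gI} : 'X_1 ^+ size s * g i \in I.
  by apply: gI (lg i); rewrite mem_map // mem_rem_uniq // inE eqxx.
rewrite mulrA -exprD => gI.
have [_ lf /negP[]] := hdf i.
exact: pencil_saturated lf gI.
Qed.

Lemma ideal_has_form r (c : 'I_r.+1 -> C) : injective c ->
  zero_dim_subscheme I r -> exists2 F : form r, F != 0 & val F \in I.
Proof.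
move=> injc [_ _ satI [d0 hI]].
have [i regi] := pencil_regular injc satI hI.
have hX (j : 'I_r.+1) : 'X_[mnm2 (r - j) j] \is [in C[2], r.-homog].
  by rewrite dhomogX /= mdeg_mnm2 /= subnK // -ltnS.
have hlX (j : 'I_r.+1) : pencil (c i) ^+ d0 * 'X_[mnm2 (r - j) j] \is (d0 + r).-homog.
  by apply: dhomogM => //; exact/dhomog_exp1/pencil_homog.
have [a [j aj]] := hilbert_dependency (fun j => DHomog (hlX j)) (hI _ (leq_addr _ _)).
pose F := \sum_j a j *: 'X_[mnm2 (r - j) j] : S.
have hF : F \is r.-homog by exact: dhomog_sum_mnm2.
rewrite (_ : \sum_i _ = pencil (c i) ^+ d0 * F); last first.
  by rewrite mulr_sumr; apply: eq_bigr => k _; rewrite scalerAr.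
move=> FI; exists (DHomog hF).
  apply: contra_neq aj => /(congr1 val)/= /(congr1 (mcoeff (mnm2 (r - j) j))).
  by rewrite mcoeff0 mcoeff_sum_mnm2.
(* The [d0] factors, nonzerodivisors modulo [I], are cancelled one at a time. *)
rewrite /=; elim: (d0) FI => [|d IH]; first by rewrite mul1r.
rewrite exprS -mulrA => /(regi (d + r)%N) h; apply/IH/h.
by apply: dhomogM => //; exact/dhomog_exp1/pencil_homog.
Qed.

End Ideal.

(** * Ideals generated by one form *)

Lemma dim_form d : \dim {: form d} = d.+1.
Proof. by rewrite dimvf /dim /= addn1 binSn. Qed.

Lemma pihomog_mulr r (F g : S) d : F \is r.-homog ->
  pihomog mdeg d (g * F) = (if (r <= d)%N then pihomog mdeg (d - r) g else 0) * F.
Proof.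
(* [msize g] makes the decomposition of [g] complete; [d.+1] makes [d - r] one of its indices. *)
move=> hF; pose k := maxn (msize g) d.+1.
have gE : g = \sum_(e < k) pihomog mdeg e g by apply: pihomog_partitionE; exact: leq_maxl.
rewrite {1}gE mulr_suml raddf_sum /=.
have hE (e : nat) : pihomog mdeg d (pihomog mdeg e g * F) =
    if (e + r == d)%N then pihomog mdeg e g * F else 0.
  have h : pihomog mdeg e g * F \is (e + r).-homog by rewrite dhomogM ?pihomogP.
  by case: eqP => [<-|/eqP ne]; [rewrite pihomog_dE | rewrite (pihomog_ne0 ne)].
under eq_bigr do rewrite hE.
rewrite -big_mkcond /=; case: leqP => rd; last first.
  by rewrite mul0r big_pred0// => e; apply/eqP; lia.
have hk : (d - r < k)%N by rewrite /k; lia.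
rewrite (big_pred1 (Ordinal hk)) //= => e.
by apply/eqP/eqP => [h|->] /=; [apply/val_inj => /=|]; lia.
Qed.

Definition mul_form r (F : form r) e (g : form e) : form (e + r) :=
  DHomog (dhomogM (valP g) (valP F)).

Lemma mul_form_is_linear r (F : form r) e : linear (@mul_form r F e).
Proof. by move=> c g h; apply/val_inj; rewrite /= mulrDl -scalerAl. Qed.

HB.instance Definition _ r (F : form r) e :=
  GRing.isLinear.Build C (form e) (form (e + r)) _ (@mul_form r F e)
    (@mul_form_is_linear r F e).

Definition principal_ideal (F : S) : {pred S} := [pred f | `[< exists g, f = g * F >]].

Lemma principal_idealP (F f : S) : reflect (exists g, f = g * F) (f \in principal_ideal F).
Proof. by rewrite inE; exact: asboolP. Qed.

(** Powers of [X_0] and [X_1] are coprime. The quotient is explicit: each monomial of [a] loses [k]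
    from its exponent of [X_0]. *)
Lemma mpolyX_dvd_coprime k (a b : S) : 'X_1 ^+ k * a = 'X_0 ^+ k * b ->
  exists c, a = c * 'X_0 ^+ k.
Proof.
move=> e; pose u := (U_(0%R) *+ k : 'X_{1..2})%MM.
exists (\sum_(m <- msupp a) a@_m *: 'X_[m - u]).
rewrite mpolyXn mulr_suml {1}[a]mpolyE; apply: eq_big_seq => m ma.
rewrite -scalerAl -mpolyXD submK //; apply/mnm_lepP => i.
rewrite /u mulmnE mnm1E; case: eqP => [<-|]; last by rewrite mul0n.
(* A monomial of [a] with [X_0]-exponent below [k], multiplied by [X_1^k], would occur in [X_0^k b],
   whose monomials all have [X_0]-exponent at least [k]. *)
rewrite mul1n leqNgt; apply/negP => mk; move: ma; rewrite mcoeff_msupp.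
rewrite -(mcoeffMX _ (U_(1%R) *+ k)%MM) -mpolyXn mulrC e mulrC mpolyXn.
rewrite -mcoeff_msupp (perm_mem (msuppMX _ _)).
move=> /mapP[n _] /(congr1 (fun m : 'X_{1..2} => m 0)).
rewrite !mnmDE !mulmnE !mnm1E /= => h; lia.
Qed.

(** Multiplication by [F] is injective, so for [d >= r] the degree-[d] part of the ideal has
    dimension [d - r + 1], that is, codimension [r]. The ideal is proper because [0 < r]. *)
Lemma principal_zero_dim r (F : form r) : (0 < r)%N -> F != 0 ->
  zero_dim_subscheme (principal_ideal (val F)) r.
Proof.
move=> r0 F0; have vF0 : val F != 0 by [].
have hF : val F \is r.-homog by exact: valP.
split.
- split; first by apply/principal_idealP; exists 0; rewrite mul0r.
    apply/principal_idealP => -[g /(congr1 (pihomog mdeg 0))].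
    rewrite (pihomog_mulr _ _ hF) leqNgt r0 mul0r pihomog_dE ?dhomog1 //.
    by move/eqP; rewrite oner_eq0.
  move=> a u v /principal_idealP[g ->] /principal_idealP[h ->].
  by apply/principal_idealP; exists (a * g + h); rewrite mulrDl mulrA.
- move=> f /principal_idealP[g ->] d; apply/principal_idealP.
  by rewrite (pihomog_mulr _ _ hF); eexists.
(* Saturation: [X_0^k f = a F] and [X_1^k f = b F] give [X_1^k a = X_0^k b], so [X_0^k] divides [a]
   and can be cancelled. *)
- move=> f k h.
  have /principal_idealP[a ea] := h (mnm2 k 0) (etrans (mdeg_mnm2 _ _) (addn0 _)).
  have /principal_idealP[b eb] := h (mnm2 0 k) (mdeg_mnm2 _ _).
  move: ea eb; rewrite !mpolyX_mnm2 !expr0 mulr1 mul1r => ea eb.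
  have [|c ac] := @mpolyX_dvd_coprime k a b.
    by apply: (mulIf vF0); rewrite -!mulrA -ea -eb mulrCA.
  have X0 : 'X_0 ^+ k != 0 :> S by rewrite expf_neq0 // -msupp_eq0 msuppX.
  apply/principal_idealP; exists c; apply: (mulfI X0).
  by rewrite ea ac mulrAC mulrC.
- exists r => d /subnK <-; set e := (d - r)%N.
  pose phi := linfun (@mul_form r F e).
  exists (limg phi) => [f|].
    apply/memv_imgP/principal_idealP => [[g _ ->]|[g fg]].
      by exists (val g); rewrite lfunE.
    exists (DHomog (pihomogP mdeg e g)); first exact: memvf.
    apply/val_inj; rewrite lfunE /= -[LHS](pihomog_dE (valP f)).
    by rewrite [val f]fg (pihomog_mulr _ _ hF) leq_addl addnK.
  rewrite limg_dim_eq ?dim_form ?addSn //.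
  apply/eqP; rewrite -subv0; apply/subvP => g /memv_capP[_].
  rewrite memv_ker lfunE /= -val_eqE /= mulf_eq0 (negbTE vF0) orbF => g0.
  by rewrite memv0 -val_eqE.
Qed.

(** * The apolar action of differential operators *)

Lemma diffopwE k (Q P : S) : (msize Q <= k)%N -> diffop Q P =
  \sum_(m : 'X_{1..2 < k}) Q@_m *: P^`M[m].
Proof.
move=> lt_Qk; rewrite /diffop (big_mksub 'X_{1..2 < k}) //=; first last.
- by move=> m /msize_mdeg_lt /leq_trans; apply.
- exact: msupp_uniq.
by rewrite big_rmcond //= => m /memN_msupp_eq0 ->; rewrite scale0r.
Qed.

(** The operator comes last, so that linearity in it can be declared as an instance. *)
Definition apply_to (P Q : S) : S := diffop Q P.

Lemma apply_to_is_linear (P : S) : linear (apply_to P).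
Proof.
move=> c p q; rewrite /apply_to; pose_big_enough l.
  rewrite !(@diffopwE l) // scaler_sumr -big_split; apply: eq_bigr => m _.
  by rewrite /= mcoeffD mcoeffZ scalerDl scalerA.
by close.
Qed.

HB.instance Definition _ (P : S) :=
  GRing.isLinear.Build C S S _ (apply_to P) (apply_to_is_linear P).

Lemma diffop_sum (P : S) (T : Type) (s : seq T) (c : T -> C) (F : T -> S) :
  diffop (\sum_(t <- s) c t *: F t) P = \sum_(t <- s) c t *: diffop (F t) P.
Proof.
rewrite -[LHS]/(apply_to P _) raddf_sum; apply: eq_bigr => t _.
exact: (linearZ_LR (apply_to P)).
Qed.

Lemma diffopX m (P : S) : diffop 'X_[m] P = P^`M[m].
Proof. by rewrite /diffop msuppX big_seq1 mcoeffX eqxx scale1r. Qed.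

Lemma diffopXM m (Q P : S) : diffop ('X_[m] * Q) P = (diffop Q P)^`M[m].
Proof.
rewrite {1}[Q]mpolyE mulr_sumr; under eq_bigr do rewrite -scalerAr -mpolyXD.
rewrite diffop_sum raddf_sum; apply: eq_bigr => n _.
by rewrite /= diffopX addmC mderivmDm mderivmZ.
Qed.

(** Each monomial of [G] only differentiates [diffop Q P], which is already zero. *)
Lemma Ann_mul (P G Q : S) : Q \in Ann P -> G * Q \in Ann P.
Proof.
rewrite !inE => /eqP Q0; rewrite [G]mpolyE mulr_suml.
under eq_bigr do rewrite -scalerAl.
by rewrite diffop_sum big1 // => m _; rewrite diffopXM Q0 raddf0 scaler0.
Qed.

Lemma apolar_length_form (P : S) r (F : form r) : (0 < r)%N -> F != 0 ->
  val F \in Ann P -> apolar_length P r.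
Proof.
move=> r0 F0 FP; exists (principal_ideal (val F)); first exact: principal_zero_dim.
by move=> f /principal_idealP[g ->]; exact: Ann_mul.
Qed.

Lemma dhomog_mderivm k m (P : S) : (mdeg m <= k)%N -> P \is k.-homog ->
  P^`M[m] \is (k - mdeg m).-homog.
Proof.
move=> mk hP; apply/dhomogP => m'; rewrite mcoeff_msupp mcoeff_mderivm.
have [e _|ne] := eqVneq (mdeg (m + m')) k; first by rewrite /= -e mdegD addKn.
by rewrite (dhomog_nemf_coeff hP) // mul0rn eqxx.
Qed.

Lemma mderivm_gt_eq0 k m (P : S) : (k < mdeg m)%N -> P \is k.-homog -> P^`M[m] = 0.
Proof.
move=> mk hP; apply/mpolyP => m'; rewrite mcoeff_mderivm mcoeff0.
by rewrite (dhomog_nemf_coeff hP) ?mul0rn //= mdegD; apply/eqP; lia.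
Qed.

(** * Cactus rank and Hankel matrices *)

Lemma dhomog2E r (F : S) : F \is r.-homog ->
  F = \sum_(q < r.+1) F@_(mnm2 (r - q) q) *: 'X_[mnm2 (r - q) q].
Proof.
move=> hF; apply: (dhomog2P hF) => [|i ir]; first exact: dhomog_sum_mnm2.
exact/esym/(mcoeff_sum_mnm2 _ (Ordinal (ir : (i < r.+1)%N))).
Qed.

(** Removing the binomial factors turns the apolarity equations into a Hankel system; [bcoef 4]
    unfolds to [qcoef]. *)
Definition bcoef k (P : S) i : C := P@_(mnm2 (k - i) i) / 'C(k, i)%:R.

(** The default value in [crank] is never taken: [X_0^(k+1)] annihilates every form of degree [k],
    so [k + 1] is an apolar length. *)
Lemma crankP k (P : form k) : apolar_length (val P) (crank (val P)) /\
  forall r, apolar_length (val P) r -> (crank (val P) <= r)%N.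
Proof.
have ex : exists r, `[< apolar_length (val P) r >].
  have hX : ('X_[mnm2 k.+1 0] : S) \is k.+1.-homog by rewrite dhomogX /= mdeg_mnm2 addn0.
  exists k.+1; apply/asboolP; apply: (apolar_length_form (F := DHomog hX)) => //.
    by rewrite -val_eqE /= -msupp_eq0 msuppX.
  by rewrite inE /= diffopX (mderivm_gt_eq0 _ (valP P)) // mdeg_mnm2 addn0.
rewrite /crank; case: pselect => // h; case: ex_minnP => r /asboolP ar minr.
by split=> // s /asboolP /minr.
Qed.

Section CharZero.
Hypothesis char0 : [pchar C] =i pred0.

Lemma natr_neq0 n : (0 < n)%N -> n%:R != 0 :> C.
Proof. by rewrite lt0n; have/pcharf0P -> := char0. Qed.

Lemma natr_inj_ord n : injective (fun i : 'I_n => i%:R : C).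
Proof.
have inj (i j : nat) : (i <= j)%N -> i%:R = j%:R :> C -> i = j.
  move=> ij /esym/eqP; rewrite -subr_eq0 -natrB // => /eqP h.
  by apply/eqP; rewrite eqn_leq ij leqNgt -subn_gt0; apply: contra_eqN h => /natr_neq0.
move=> i j e; apply/val_inj.
by case: (leqP i j) => [|/ltnW] /inj; [apply | move=> h; exact/esym/h].
Qed.

(** Length 0 would put a nonzero form of degree 0, a unit, into a proper ideal. *)
Lemma crank_gt0 k (P : form k) : (0 < crank (val P))%N.
Proof.
rewrite lt0n; apply/negP => /eqP c0; have [[I zI _] _] := crankP P.
move: zI; rewrite c0 => zI; have [idI _ _ _] := zI.
have [F F0 FI] := ideal_has_form idI (@natr_inj_ord 1) zI.
have FE : val F = (val F)@_(mnm2 0 0) *: 1.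
  by rewrite {1}(dhomog2E (valP F)) big_ord1 mpolyX_mnm2 mul1r.
have [_ /negP I1 _] := idI.
apply/I1; apply: (ideal_scale_inv idI) (_ : (val F)@_(mnm2 0 0) *: 1 \in I).
  by apply: contra_neq F0 => f0; apply/val_inj; rewrite /= [LHS]FE f0 scale0r.
by rewrite -FE.
Qed.

Lemma crank_leP k (P : form k) r : (0 < r)%N ->
  (crank (val P) <= r)%N <-> exists2 F : form r, F != 0 & val F \in Ann (val P).
Proof.
move=> r0; have [[I zI IA] minP] := crankP P; split=> [le|[F F0 FA]]; last first.
  exact/minP/apolar_length_form/FA.
have [idI _ _ _] := zI.
have [F F0 FI] := ideal_has_form idI (@natr_inj_ord _) zI.
(* A power of [X_0] raises the degree from the cactus rank to [r] without leaving the
   annihilator. *)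
have h : 'X_0 ^+ (r - crank (val P)) * val F \is r.-homog.
  have hX : 'X_0 ^+ (r - crank (val P)) \is [in C[2], (r - crank (val P)).-homog].
    exact/dhomog_exp1/dhomogXU.
  by have := dhomogM hX (valP F); rewrite subnK.
exists (DHomog h); last exact/Ann_mul/IA.
by rewrite -val_eqE /= mulf_neq0 // expf_neq0 // -msupp_eq0 msuppX.
Qed.

Lemma bcoefE k (P : S) i : (i <= k)%N -> P@_(mnm2 (k - i) i) = 'C(k, i)%:R * bcoef k P i.
Proof. by move=> ik; rewrite /bcoef mulrC divfK // natr_neq0 // bin_gt0. Qed.

Lemma bcoefZ k c (P : S) i : bcoef k (c *: P) i = c * bcoef k P i.
Proof. by rewrite /bcoef mcoeffZ mulrA. Qed.

Lemma bcoef_inj k (P Q : form k) :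
  (forall i, (i <= k)%N -> bcoef k (val P) i = bcoef k (val Q) i) -> P = Q.
Proof.
move=> e; apply/val_inj/(dhomog2P (valP P) (valP Q)) => i ik.
by rewrite !bcoefE // e.
Qed.

(** The falling factorials from the derivatives, times ['C(k, q + v)], give
    [k! / ((k - r - v)! v!)], which does not depend on [q]. *)
Lemma mcoeff_diffop k r (P : form k) (F : form r) v : (r + v <= k)%N ->
  (diffop (val F) (val P))@_(mnm2 (k - r - v) v) =
  k`!%:R / ((k - r - v)`!%:R * v`!%:R) *
    \sum_(q < r.+1) (val F)@_(mnm2 (r - q) q) * bcoef k (val P) (q + v).
Proof.
move=> rvk; rewrite {1}(dhomog2E (valP F)) diffop_sum raddf_sum mulr_sumr.
apply: eq_bigr => q _; have qr : (q <= r)%N by rewrite -ltnS.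
rewrite /= diffopX mcoeffZ mulrCA; congr (_ * _).
rewrite mcoeff_mderivm mnm2D big_ord_recl big_ord1 !mnm2_0.
have -> : lift ord0 ord0 = 1 :> 'I_2 by apply/val_inj.
rewrite !mnm2_1.
have -> : (r - q + (k - r - v) = k - (q + v))%N by lia.
rewrite bcoefE; last by lia.
rewrite -[LHS]mulr_natr mulrAC; congr (_ * _); rewrite -natrM -natrM.
apply/eqP; rewrite eq_sym; apply/eqP; apply: canLR (mulfK _) _.
  by apply: natr_neq0; rewrite muln_gt0 !fact_gt0.
rewrite -natrM; congr (_%:R).
have := @bin_fact k (q + v); have := @ffact_fact (q + v) q (leq_addr _ _).
have := @ffact_fact (k - (q + v)) (r - q).
have -> : (k - (q + v) - (r - q) = k - r - v)%N by lia.
rewrite addKn => e1 e2 <-; last by lia.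
rewrite -e2 -e1; last by lia.
by rewrite -!mulnA; congr (_ * _)%N; ring.
Qed.

(** The sums are the coefficients of a form of degree [k - r], up to factorial factors that are
    nonzero in characteristic zero. *)
Lemma Ann_hankelP k r (P : form k) (F : form r) : (r <= k)%N ->
  val F \in Ann (val P) <-> forall v, (v <= k - r)%N ->
    \sum_(q < r.+1) (val F)@_(mnm2 (r - q) q) * bcoef k (val P) (q + v) = 0.
Proof.
move=> rk; rewrite inE; split=> [/eqP D0 v vk|h].
  have := @mcoeff_diffop _ _ P F v; rewrite D0 mcoeff0 => /(_ _)/esym/eqP.
  rewrite mulf_eq0 mulf_eq0 invr_eq0 mulf_eq0 !(negbTE (natr_neq0 (fact_gt0 _))) /=.
  by move=> h; apply/eqP/h; lia.
apply/eqP; apply: (@dhomog2P (k - r)) => [||v vk].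
- rewrite {1}(dhomog2E (valP F)) diffop_sum rpred_sum // => q _; rewrite rpredZ //.
  have dq : mdeg (mnm2 (r - q) q) = r by rewrite mdeg_mnm2 subnK // -ltnS.
  rewrite diffopX -[r in (k - r)%N]dq dhomog_mderivm ?dq //; exact: valP.
- exact: dhomog0.
- by rewrite mcoeff_diffop ?h ?mulr0 ?mcoeff0 //; lia.
Qed.

(** The catalecticant: for [r <= k], its left kernel consists of the coefficient vectors of the
    forms of degree [r] in [Ann P]. *)
Definition hankel k r (P : S) : 'M[C]_(r.+1, (k - r).+1) :=
  \matrix_(q, v) bcoef k P (q + v).

Lemma crank_hankelP k r (P : form k) : (0 < r <= k)%N ->
  (crank (val P) <= r)%N <->
  exists2 x : 'rV[C]_r.+1, x != 0 & x *m hankel k r (val P) = 0.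
Proof.
case/andP => r0 rk; split=> [/(crank_leP _ r0)[F F0 /(Ann_hankelP _ _ rk) FA]|[x x0 xH]].
  exists (\row_q (val F)@_(mnm2 (r - q) q)).
    apply: contra_neq F0 => x0; apply/val_inj.
    rewrite /= [LHS](dhomog2E (valP F)) big1 // => q _.
    by have := congr1 (fun y : 'rV[C]_r.+1 => y 0 q) x0; rewrite !mxE => ->; rewrite scale0r.
  apply/rowP => v; rewrite !mxE -[RHS](FA v) -1?ltnS //.
  by apply: eq_bigr => q _; rewrite !mxE.
pose F := \sum_(q < r.+1) x 0 q *: 'X_[mnm2 (r - q) q] : S.
have hF : F \is r.-homog by exact: dhomog_sum_mnm2.
have FE (q : 'I_r.+1) : F@_(mnm2 (r - q) q) = x 0 q by exact: mcoeff_sum_mnm2.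
apply/(crank_leP _ r0); exists (DHomog hF).
  apply: contra_neq x0 => /(congr1 val)/= F0.
  by apply/rowP => q; rewrite -FE F0 mcoeff0 mxE.
apply/Ann_hankelP => // v; rewrite -ltnS => vk.
have /rowP/(_ (Ordinal vk)) := xH; rewrite !mxE => xv; rewrite -[RHS]xv.
by apply: eq_bigr => q _; rewrite FE mxE.
Qed.

(** For [k < 2r] the matrix has more rows, [r + 1], than columns, [k - r + 1]. *)
Lemma crank_le_half k r (P : form k) : (r <= k < r.*2)%N -> (crank (val P) <= r)%N.
Proof.
case/andP => rk kr; apply/crank_hankelP; first by lia.
have : kermx (hankel k r (val P)) != 0.
  rewrite kermx_eq0 /row_free neq_ltn; apply/orP; left.
  by apply: leq_ltn_trans (rank_leq_col _) _; lia.
by case/rowV0Pn => x /sub_kermxP xH x0; exists x.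
Qed.

(** * The catalecticant invariant and powers of linear forms *)

Lemma det_hankel42 (P : S) : \det (hankel 4 2 P : 'M_3) = g3 P.
Proof.
rewrite (expand_det_row _ ord0) !big_ord_recl big_ord0 /cofactor.
rewrite !(expand_det_row _ ord0) !big_ord_recl !big_ord0 /cofactor !det_mx11 !mxE /=.
rewrite /g3 -![qcoef P _]/(bcoef 4 P _).
rewrite /bump /= ?addn0 ?add0n ?expr0 ?expr1.
move: (bcoef 4 P) => a; ring.
Qed.

Lemma crank_le2P (P : form 4) : (crank (val P) <= 2)%N <-> g3 (val P) = 0.
Proof.
apply: (iff_trans (crank_hankelP P (isT : (0 < 2 <= 4)%N))).
rewrite -det_hankel42; split; first by move=> h; apply/eqP/det0P.
by move/eqP/det0P.
Qed.

Definition linear_form (a b : C) : S := a *: 'X_0 + b *: 'X_1.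

Lemma linear_form_homog a b : linear_form a b \is 1.-homog.
Proof. by rewrite rpredD ?rpredZ ?dhomogXU. Qed.

Lemma linear_formE (F : S) : F \is 1.-homog ->
  F = linear_form F@_(mnm2 1 0) F@_(mnm2 0 1).
Proof.
move=> hF; rewrite {1}(dhomog2E hF) !big_ord_recl big_ord0 addr0 !mpolyX_mnm2.
by rewrite /= expr0 expr1 mulr1 mul1r.
Qed.

Lemma linear_form_eq0 a b : (linear_form a b == 0) = (a == 0) && (b == 0).
Proof.
have e (i j : nat) : (linear_form a b)@_(mnm2 i j) =
    a * (mnm2 1 0 == mnm2 i j)%:R + b * (mnm2 0 1 == mnm2 i j)%:R.
  have -> : linear_form a b = a *: 'X_[mnm2 1 0] + b *: 'X_[mnm2 0 1].
    by rewrite !mpolyX_mnm2 expr0 expr1 mulr1 mul1r.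
  by rewrite mcoeffD !mcoeffZ !mcoeffX.
apply/eqP/andP => [l0|[/eqP-> /eqP->]]; last by rewrite /linear_form !scale0r addr0.
have := e 1%N 0%N; have := e 0%N 1%N; rewrite l0 !mcoeff0 !eq_mnm2 /=.
by rewrite !mulr0 !mulr1 add0r addr0 => <- <-.
Qed.

Lemma bcoef_linear_pow k a b i : (i <= k)%N ->
  bcoef k (linear_form a b ^+ k) i = a ^+ (k - i) * b ^+ i.
Proof.
move=> ik; rewrite /linear_form exprDn /bcoef raddf_sum /=.
have E (j : 'I_k.+1) :
    ((a *: 'X_0 : S) ^+ (k - j) * (b *: 'X_1) ^+ j *+ 'C(k, j))@_(mnm2 (k - i) i) =
    a ^+ (k - j) * b ^+ j * (j == i :> nat)%:R *+ 'C(k, j).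
  rewrite !exprZn -scalerAl -scalerAr scalerA -mpolyX_mnm2 mcoeffMn mcoeffZ mcoeffX.
  rewrite eq_mnm2 andbC; case: eqP => //= ->; by rewrite eqxx.
under eq_bigr do rewrite E.
rewrite (bigD1 (Ordinal (ik : (i < k.+1)%N))) //= eqxx mulr1.
rewrite big1 ?addr0 => [|j ji].
  by rewrite -mulr_natr mulfK // natr_neq0 // bin_gt0.
have /negbTE-> : (j != i :> nat) by [].
by rewrite mulr0 mul0rn.
Qed.

(** A kernel vector [(x_0, x_1)] is a recurrence [x_0 b_v + x_1 b_(v+1) = 0], whose solutions are
    proportional to the coefficients of [(x_1 X_0 - x_0 X_1)^k]. *)
Lemma crank_le1P k (P : form k) : (0 < k)%N -> (crank (val P) <= 1)%N <->
  exists (c : C) (l : form 1), l != 0 /\ P = c *: form_pow k l.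
Proof.
move=> k0; apply: (iff_trans (crank_hankelP P (k0 : (0 < 1 <= k)%N))).
pose H (x : 'rV[C]_2) := forall v, (v < k)%N ->
  x 0 0 * bcoef k (val P) v + x 0 1 * bcoef k (val P) v.+1 = 0.
have HP (x : 'rV[C]_2) : x *m hankel k 1 (val P) = 0 <-> H x.
  have xE (v : 'I_(k - 1).+1) : (x *m hankel k 1 (val P)) 0 v =
      x 0 0 * bcoef k (val P) v + x 0 1 * bcoef k (val P) v.+1.
    rewrite mxE big_ord_recl big_ord1 !mxE /= add0n.
    by have -> : lift ord0 ord0 = 1 :> 'I_2 by apply/val_inj.
  split=> [/rowP xH v vk|xH]; last first.
    by apply/rowP => v; rewrite xE mxE xH //; have := ltn_ord v; lia.
  have vk' : (v < (k - 1).+1)%N by lia.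
  by have := xH (Ordinal vk'); rewrite xE mxE.
split=> [[x x0 /HP]|[c [l [l0 PE]]]].
  rewrite /H => xH.
  set f0 := x 0 0 in xH; set f1 := x 0 1 in xH; set b := bcoef k (val P) in xH *.
  have [c bE] : exists c, forall v, (v <= k)%N -> b v = c * (f1 ^+ (k - v) * (- f0) ^+ v).
    (* If [f1 = 0], only [b k] can be nonzero and the power is one of [X_1]; otherwise the
       progression has ratio [- f0 / f1]. *)
    have [f10|f1N] := eqVneq f1 0.
      have f0N : f0 != 0.
        apply: contra_neq x0 => f00; apply/rowP => -[[|[|i]] hi] //; rewrite mxE.
          by rewrite -[RHS]f00; congr (x 0 _); apply/val_inj.
        by rewrite -[RHS]f10; congr (x 0 _); apply/val_inj.
      exists (b k / (- f0) ^+ k) => v; rewrite leq_eqVlt => /orP[/eqP->|vk].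
        by rewrite subnn expr0 mul1r divfK // expf_neq0 // oppr_eq0.
      rewrite f10 expr0n subn_eq0 leqNgt vk mul0r mulr0.
      by have /eqP := xH v vk; rewrite f10 mul0r addr0 mulf_eq0 (negbTE f0N) => /eqP.
    exists (b 0%N / f1 ^+ k); elim=> [_|v IH vk].
      by rewrite subn0 expr0 mulr1 divfK // expf_neq0.
    have := xH v vk; rewrite IH 1?ltnW // => /eqP; rewrite addrC addr_eq0 => /eqP e.
    apply: (mulfI f1N); rewrite e.
    by rewrite -(subnSK vk) !exprS; ring.
  exists c, (DHomog (linear_form_homog f1 (- f0))); split.
    rewrite -val_eqE /= linear_form_eq0 oppr_eq0.
    apply: contra_neqN x0 => /andP[/eqP f10 /eqP f00].
    apply/rowP => -[[|[|i]] hi] //; rewrite mxE.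
      by rewrite -[RHS]f00; congr (x 0 _); apply/val_inj.
    by rewrite -[RHS]f10; congr (x 0 _); apply/val_inj.
  apply: bcoef_inj => i ik; rewrite val_formZ bcoefZ /= bcoef_linear_pow //.
  exact: bE.
have := linear_formE (valP l).
set a := _@_(mnm2 1 0); set b := _@_(mnm2 0 1) => lE.
have Hx : a != 0 \/ b != 0.
  move: l0; rewrite -val_eqE /= [val l]lE linear_form_eq0 negb_and; exact: orP.
(* The operator [b d/dX_0 - a d/dX_1] kills [a X_0 + b X_1] and hence its powers. *)
exists (\row_(q < 2) if q == 0 then b else - a).
  case: Hx => n0; apply: contra_neq n0 => /rowP h.
    by have := h 1; rewrite !mxE /= => /eqP; rewrite oppr_eq0 => /eqP.
  by have := h 0; rewrite !mxE.
apply/HP => v vk.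
rewrite !mxE /= PE val_formZ !bcoefZ /= lE !bcoef_linear_pow ?(ltnW vk) //.
by rewrite -(subnSK vk) !exprS; ring.
Qed.

(** * The strata in projective space *)

Lemma range_veroneseP k (P : form k) (P0 : P != 0) :
  range (veronese k) (projPt P0) <->
  exists (c : C) (l : form 1), l != 0 /\ P = c *: form_pow k l.
Proof.
split=> [[x _ /esym/projPtP[c _ e]]|[c [l [l0 e]]]].
  by exists c, (vpick (val x)); split=> //; exact: vpick_projSpace_neq0.
exists (projPt l0) => //; rewrite veroneseE; apply/esym/projPtP; exists c => //.
by apply: contraNneq P0 => c0; rewrite e c0 scale0r.
Qed.

Lemma projPt_vpick (V : vectType C) (x : projSpace V) :
  x = projPt (vpick_projSpace_neq0 x).
Proof.
apply/val_inj/eqP; rewrite eq_sym eqEdim /= -memvE memv_pick dim_vline.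
by rewrite vpick_projSpace_neq0 (eqP (valP x)).
Qed.

Theorem quartic_crank_strata :
  [/\ @crank_stratum C 4 1 = range (veronese 4),
      @crank_stratum C 4 2 = Zg3 `\` range (veronese 4) &
      @crank_stratum C 4 3 = ~` Zg3].
Proof.
split; apply/seteqP; split=> x; rewrite [x]projPt_vpick;
  move: (vpick _) (vpick_projSpace_neq0 x) => P P0.
(* The criteria for rank at most 1 and at most 2, with the bounds [0 < crank P <= 3], determine the
   exact rank. *)
all: have := crank_gt0 P; have := crank_le_half P (isT : (3 <= 4 < 6)%N).
all: have := crank_le2P P; have := crank_le1P P isT.
all: rewrite -(range_veroneseP P0) -(Zg3P P0) crank_stratumP => v1 z2 c3 c0.
- by move=> e; apply/v1; rewrite e.
- by move/v1 => le1; apply/eqP; rewrite eqn_leq le1.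
- by move=> e; split; [apply/z2; rewrite e | move/v1; rewrite e].
- by case=> /z2 le2 nv; apply/eqP; rewrite eqn_leq le2 ltnNge; apply/negP => /v1.
- by move=> e /z2; rewrite e.
- by move=> nz; apply/eqP; rewrite eqn_leq c3 ltnNge; apply/negP => /z2.
Qed.

End CharZero.

End Binary.

Theorem mainTheorem9 (R : realType) :
  [/\ @crank_stratum R[i] 4 1 = range (veronese 4),
      @crank_stratum R[i] 4 2 = Zg3 `\` range (veronese 4) &
      @crank_stratum R[i] 4 3 = ~` Zg3].
Proof. exact/quartic_crank_strata/Num.Theory.pchar_num. Qed.
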